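(* $\mathcal{B}(\Delta_\xi, r)$ is a basis of $\mathcal{P}_r\Lambda^1(\Delta)$; that is, the family of 1-forms $w(\xi;f,k,\alpha)$ indexed by the triplets $(f,k,\alpha)\in\mathcal{B}(\Delta_\xi, r)$ is a basis of $\mathcal{P}_r\Lambda^1(\Delta)$.
   Context: $D \ge 1$ and $r \ge 1$ are integers and $\Delta = \Delta_\xi = [v_0,\dots,v_D]\subset\mathbb{R}^D$ is a non-degenerate $D$-simplex with vertex labels $0,\dots,D$, naturally ordered. Its barycentric coordinates $\xi = (\xi_0,\dots,\xi_D)$ are the affine functions with $\xi_i(v_j) = \delta_{ij}$. $\mathcal{P}_r(\Delta)$ is the space of polynomials of degree at most $r$ on $\Delta$, and $\mathcal{P}_r\Lambda^1(\Delta) = \{\sum_{i=0}^D p_i\,\mathrm{d}\xi_i : p_i\in\mathcal{P}_r(\Delta)\}$ is the space of differential 1-forms with coefficients in $\mathcal{P}_r(\Delta)$. A face is identified with its label set $f\subseteq\{0,\dots,D\}$; $\dim f = |f|-1$, $\min f$ is the smallest label, $f\setminus k$ means $f\setminus\{k\}$. For $\alpha\in\mathbb{N}_0^{D+1}$, $|\alpha| = \sum_i\alpha_i$, $\operatorname{supp}(\alpha) = \{i:\alpha_i>0\}$, $\mathbf{1}_\alpha\in\{0,1\}^{D+1}$ has $(\mathbf{1}_\alpha)_i = 1$ iff $\alpha_i>0$, and $b(\xi;\alpha) = \prod_i\xi_i^{\alpha_i}$. For a face $f$ with $\dim f\ge1$, $k\in f$, $s\in\{0,1\}^{D+1}$ with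 $\operatorname{supp}(s)\cup\{k\} = f$, set $\psi(\xi;f,k,s) = \mathrm{d}\xi_k - \frac{s_k}{|s|}\sum_{j\in f}\mathrm{d}\xi_j$; it is anchored if $s_i = 0$ for all $i<\min(f\setminus k)$. $\mathcal{B}(\Delta_\xi, r)$ is the set of triplets $(f,k,\alpha)$ with $\dim f\ge1$, $k\in f$, $|\alpha| = r$, $\operatorname{supp}(\alpha)\cup\{k\} = f$ and $\psi(\xi;f,k,\mathbf{1}_\alpha)$ anchored; $w(\xi;f,k,\alpha) = b(\xi;\alpha)\,\psi(\xi;f,k,\mathbf{1}_\alpha)$. *)

(* Defs.v *)
From mathcomp Require Import all_boot all_order all_algebra.
From mathcomp Require mpoly.

Set Implicit Arguments.
Unset Strict Implicit.
Unset Printing Implicit Defensive.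

(* The notations of mpoly clash with those of the analysis library, hence the
   local import before the latter is loaded. A nonzero polynomial of degree d has msize d.+1, and
   msize 0 = 0. *)
Module PolyFun.
Import mpoly.

Definition poly_fun_on (K : comNzRingType) (n r : nat) (T : Type)
    (coor : T -> 'I_n -> K) (p : T -> K) : Prop :=
  exists2 P : {mpoly K[n]}, (msize P <= r.+1)%N &
    forall x, p x = P.@[coor x].

End PolyFun.

From mathcomp Require Import classical_sets functions reals topology.
From mathcomp Require Import normedtype derive.

Import Order.TTheory GRing.Theory Num.Theory.
Import numFieldNormedType.Exports.
Local Open Scope ring_scope.

(* The family (e i), i in B, is a basis of the subspace S: it is linearly
   independent and its linear span is S. Finite linear combinations are used,
   so that B need not be given as a finite type. *)
Definition is_basis (K : fieldType) (V : lmodType K) (I : choiceType)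
    (B : set I) (e : I -> V) (S : set V) : Prop :=
  (forall (s : seq I) (c : I -> K), uniq s -> (forall i, i \in s -> B i) ->
     \sum_(i <- s) c i *: e i = 0 -> forall i, i \in s -> c i = 0) /\
  (forall u, S u <-> exists (s : seq I) (c : I -> K),
     (forall i, i \in s -> B i) /\ u = \sum_(i <- s) c i *: e i).

Section Simplex.
Variables (R : realType) (D : nat).
Implicit Types (v : 'I_D.+1 -> 'rV[R]_D) (xi : 'I_D.+1 -> 'rV[R]_D -> R).

Definition nondegenerate_simplex v : Prop :=
  forall c : 'I_D.+1 -> R,
    \sum_i c i = 0 -> \sum_i c i *: v i = 0 -> forall i, c i = 0.

Definition simplex v : set 'rV[R]_D :=
  [set x | exists c : 'I_D.+1 -> R,
     [/\ forall i, 0 <= c i, \sum_i c i = 1 & x = \sum_i c i *: v i]]%classic.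

Definition affine (g : 'rV[R]_D -> R) : Prop :=
  exists (l : {linear 'rV[R]_D -> R^o}) (b : R), forall x, g x = l x + b.

Definition barycentric v xi : Prop :=
  (forall i, affine (xi i)) /\ (forall i j, xi i (v j) = (i == j)%:R).

Definition poly_space v (r : nat) : set (simplex v -> R) :=
  [set p | PolyFun.poly_fun_on r (fun x : simplex v => val x ord0) p]%classic.

Local Notation form1 v := (simplex v -> 'Hom('rV[R]_D, R^o)).

Definition ext_d (g : 'rV[R]_D -> R) (x : 'rV[R]_D) : 'Hom('rV[R]_D, R^o) :=
  linfun ('d (g : 'rV[R]_D -> R^o) x : 'rV[R]_D -> R^o).

Definition form_space v xi (r : nat) : set (form1 v) :=
  [set u | exists p : 'I_D.+1 -> simplex v -> R,
     (forall i, poly_space r (p i)) /\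
     u = (fun x => \sum_i p i x *: ext_d (xi i) (val x))]%classic.

Local Notation multi_index := {ffun 'I_D.+1 -> nat}.

Implicit Types (f : {set 'I_D.+1}) (k : 'I_D.+1) (a s : multi_index).

(* Truncated at the empty face, which is harmless for the condition
   1 <= dim f. *)
Definition dim_face f : nat := #|f|.-1.

(* All labels are at most D, so this is the smallest element of a nonempty f. *)
Definition min_label f : nat := \big[minn/D]_(i in f) (i : nat).

Definition weight a : nat := \sum_i a i.

Definition supp a : {set 'I_D.+1} := [set i | (0 < a i)%N]%SET.

Definition indic a : multi_index := [ffun i => (0 < a i)%N : nat].

Definition bern xi a (x : 'rV[R]_D) : R := \prod_i xi i x ^+ a i.

(* Meaningful for s with values in {0, 1} and supp s :|: {k} = f, 1 <= dim f,
   in which case weight s is nonzero. *)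
Definition psi xi f k s (x : 'rV[R]_D) : 'Hom('rV[R]_D, R^o) :=
  ext_d (xi k) x -
    ((s k)%:R / (weight s)%:R) *: \sum_(j in f) ext_d (xi j) x.

Definition anchored f k s : Prop :=
  forall i : 'I_D.+1, (i < min_label (f :\ k))%N -> s i = 0%N.

Local Notation triplet := ({set 'I_D.+1} * 'I_D.+1 * multi_index)%type.

Definition basis_triplets (r : nat) : set triplet :=
  [set t | let: (f, k, a) := t in
     [/\ (1 <= dim_face f)%N, k \in f, weight a = r,
         supp a :|: [set k]%SET = f & anchored f k (indic a)]]%classic.

Definition w_form v xi (t : triplet) : form1 v :=
  let: (f, k, a) := t in
  fun x => bern xi a (val x) *: psi xi f k (indic a) (val x).

End Simplex.

Arguments poly_space {R D} v r _.
Arguments form_space {R D} v xi r _.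
Arguments basis_triplets D r _ : clear implicits.
Arguments w_form {R D} v xi t _.

(* Main.v *)
(** Since the barycentric coordinates sum to 1, a polynomial of degree at most r
    is a combination of the monomials b(xi; alpha) with |alpha| = r, and these
    are linearly independent on the simplex. So it suffices to show that, for
    each alpha with support S and m = min S, the covectors psi(f, k, 1_alpha)
    of the triplets (f, k, alpha) form a basis of the span of the d xi_i, whose
    only relation is sum_i d xi_i = 0. The anchoring condition says exactly
    k <> m, so there are D of them. They generate: d xi_k = psi_k for k outside
    S, hence sum_(j in S) d xi_j = - sum_(j notin S) d xi_j is generated, hence
    so is d xi_k for k in S other than m. They are free: in a vanishing
    combination with coefficients c_k, all the coefficients of the d xi_i are
    equal, and comparing the one at m with those on S and then off S
    gives c = 0. *)

Require Import Defs.
From mathcomp Require Import all_boot all_order all_algebra.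
From mathcomp Require mpoly.

Set Implicit Arguments.
Unset Strict Implicit.
Unset Printing Implicit Defensive.

Import Order.TTheory GRing.Theory Num.Theory.
Local Open Scope ring_scope.

(** * Polynomial functions *)

Module PolyFunTheory.
Import mpoly Defs.PolyFun.

Section PolyFunTheory.
Variables (K : fieldType) (n : nat) (T : Type) (coor : T -> 'I_n -> K).

Lemma poly_fun_on_cst r (a : K) : poly_fun_on r coor (fun=> a).
Proof.
exists a%:MP => [|x]; last by rewrite mevalC.
by rewrite msizeC; case: (a != 0).
Qed.

Lemma poly_fun_on_coor j : poly_fun_on 1 coor (fun x => coor x j).
Proof.
by exists 'X_j => [|x]; [rewrite msizeX mdeg1 | rewrite mevalXU].
Qed.

Lemma poly_fun_onD r (p q : T -> K) :
  poly_fun_on r coor p -> poly_fun_on r coor q ->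
  poly_fun_on r coor (fun x => p x + q x).
Proof.
move=> [P leP eP] [Q leQ eQ]; exists (P + Q) => [|x].
  by apply: leq_trans (msizeD_le _ _) _; rewrite geq_max leP.
by rewrite mevalD eP eQ.
Qed.

Lemma poly_fun_on_sum r (I : Type) (s : seq I) (p : I -> T -> K) :
  (forall i, poly_fun_on r coor (p i)) ->
  poly_fun_on r coor (fun x => \sum_(i <- s) p i x).
Proof.
move=> hp; elim: s => [|i s IHs].
  have [P leP eP] := poly_fun_on_cst r 0.
  by exists P => // x; rewrite big_nil -eP.
have [P leP eP] := poly_fun_onD (hp i) IHs.
by exists P => // x; rewrite big_cons -eP.
Qed.

Lemma poly_fun_onM r s (p q : T -> K) :
  poly_fun_on r coor p -> poly_fun_on s coor q ->
  poly_fun_on (r + s) coor (fun x => p x * q x).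
Proof.
move=> [P leP eP] [Q leQ eQ]; exists (P * Q) => [|x].
  have [->|P0] := eqVneq P 0; first by rewrite mul0r msize0.
  have [->|Q0] := eqVneq Q 0; first by rewrite mulr0 msize0.
  rewrite msizeM //; apply: leq_trans (_ : (r.+1 + s.+1).-1 <= _)%N.
    by rewrite -!subn1 leq_sub2r // leq_add.
  by rewrite addnS /= addSn.
by rewrite mevalM eP eQ.
Qed.

Lemma poly_fun_onX r m (p : T -> K) :
  poly_fun_on r coor p -> poly_fun_on (m * r) coor (fun x => p x ^+ m).
Proof.
move=> hp; elim: m => [|m IHm]; first exact: poly_fun_on_cst.
have [P leP eP] := poly_fun_onM hp IHm.
by exists P => [|x]; rewrite ?mulSn // exprS -eP.
Qed.

Lemma poly_fun_on_prod (I : Type) (s : seq I) (d : I -> nat) (p : I -> T -> K) :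
  (forall i, poly_fun_on (d i) coor (p i)) ->
  poly_fun_on (\sum_(i <- s) d i)%N coor (fun x => \prod_(i <- s) p i x).
Proof.
move=> hp; elim: s => [|i s IHs].
  rewrite big_nil; have [P leP eP] := poly_fun_on_cst 0 1.
  by exists P => // x; rewrite big_nil -eP.
rewrite big_cons; have [P leP eP] := poly_fun_onM (hp i) IHs.
by exists P => // x; rewrite big_cons -eP.
Qed.

(* Each monomial of degree d is multiplied by [(\sum_i y i) ^+ (r - d)], which
   equals 1, and the affine coordinates are expanded in y. *)
Lemma poly_fun_on_homogenize r m (y : T -> 'I_m -> K) (A : 'I_n -> 'I_m -> K)
    (p : T -> K) :
  (forall x, \sum_i y x i = 1) ->
  (forall x j, coor x j = \sum_i A j i * y x i) ->
  poly_fun_on r coor p ->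
  exists (s : seq {ffun 'I_m -> nat}) (c : {ffun 'I_m -> nat} -> K),
    (forall a, a \in s -> (\sum_i a i)%N = r) /\
    forall x, p x = \sum_(a <- s) c a * \prod_i y x i ^+ a i.
Proof.
move=> sum_y coorE [P leP eP].
(* [X j] and [S] are linear forms in the new variables whose values at [y x] are [coor x j] and
   1. *)
pose X j : {mpoly K[m]} := \sum_i A j i *: 'X_i.
pose S : {mpoly K[m]} := \sum_i 'X_i.
have homX j : X j \is 1.-homog.
  by apply: rpred_sum => i _; apply: dhomogZ; rewrite dhomogX /= mdeg1.
have homS : S \is 1.-homog.
  by apply: rpred_sum => i _; rewrite dhomogX /= mdeg1.
pose Q := \sum_(u <- msupp P)
  P@_u *: (\prod_j X j ^+ u j * S ^+ (r - mdeg u)).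
have homQ : Q \is r.-homog.
  rewrite /Q big_seq; apply: rpred_sum => u Pu; apply: dhomogZ.
  (* [msize] is the degree plus one, so every monomial of [P] has degree at most [r] and the
     subtraction [r - mdeg u] is not truncated. *)
  have leu : (mdeg u <= r)%N by rewrite -ltnS (leq_trans (msize_mdeg_lt Pu)).
  have homSX : S ^+ (r - mdeg u) \is (r - mdeg u).-homog.
    by have := dhomogMn (r - mdeg u) homS; rewrite mul1n.
  suff homXu : \prod_j X j ^+ u j \is (mdeg u).-homog.
    by have := dhomogM homXu homSX; rewrite subnKC.
  rewrite mdegE; elim: (index_enum _) => [|j l IHl].
    by rewrite !big_nil dhomog1.
  rewrite !big_cons; apply: dhomogM => //.
  by have := dhomogMn (u j) (homX j); rewrite mul1n.
pose ff (u : 'X_{1..m}) := [ffun i => u i].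
exists [seq ff u | u <- msupp Q], (fun a => Q@_[multinom a i | i < m]); split.
  move=> _ /mapP[u Qu ->]; rewrite -(dhomog_mf homQ Qu) /= mdegE.
  by apply: eq_bigr => i _; rewrite ffunE.
move=> x; rewrite big_map eP.
transitivity Q.@[y x]; last first.
  rewrite mevalE; apply: eq_bigr => u _.
  congr (Q@_ _ * _); first by apply/mnmP => i; rewrite mnmE ffunE.
  by apply: eq_bigr => i _; rewrite ffunE.
rewrite mevalE /Q raddf_sum; apply: eq_bigr => u _ /=.
rewrite mevalZ mevalM rmorph_prod /= !rmorphXn /=; congr (_ * _).
have -> : S.@[y x] = 1.
  rewrite raddf_sum -[RHS](sum_y x); apply: eq_bigr => i _.
  exact: mevalXU.
rewrite expr1n mulr1; apply: eq_bigr => j _.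
rewrite rmorphXn /=; congr (_ ^+ _).
rewrite coorE raddf_sum; apply: eq_bigr => i _ /=.
by rewrite mevalZ mevalXU.
Qed.

End PolyFunTheory.
End PolyFunTheory.
From mathcomp Require Import boolp classical_sets functions reals topology.
From mathcomp Require Import matrix_normedtype normedtype derive.
Import numFieldNormedType.Exports.

(** * Finite linear combinations *)

(** Moves sums over lists, possibly with repetitions, to one common duplicate-free list; an index
    absent from [s] gets multiplicity 0. *)
Lemma sum_count_mem (V : nmodType) (I : eqType) (s u : seq I) (F : I -> V) :
  uniq u -> {subset s <= u} ->
  \sum_(i <- s) F i = \sum_(i <- u) F i *+ count_mem i s.
Proof.
move=> uniq_u; elim: s => [|x s IHs] sub_s; first by rewrite big_nil big1.
have su : {subset s <= u} by move=> y sy; rewrite sub_s // inE sy orbT.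
rewrite big_cons (IHs su) /=.
under [RHS]eq_bigr do rewrite mulrnDr.
rewrite big_split /=; congr (_ + _).
rewrite (bigD1_seq x) ?sub_s ?mem_head //= eqxx mulr1n big1 ?addr0 // => y.
by rewrite eq_sym => /negPf ->.
Qed.

Section FiniteCombinations.
Variables (K : fieldType) (V : lmodType K) (I : choiceType).
Variables (B : set I) (e : I -> V).

(** This is the spanning clause of [is_basis]. Since the list may repeat indices, adding two
    combinations requires counting multiplicities. *)
Definition lin_comb (u : V) : Prop := exists (s : seq I) (c : I -> K),
  (forall i, i \in s -> B i) /\ u = \sum_(i <- s) c i *: e i.

Lemma lin_comb0 : lin_comb 0.
Proof. by exists [::], (fun=> 0); split; rewrite ?big_nil. Qed.

Lemma lin_comb_gen i : B i -> lin_comb (e i).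
Proof.
move=> Bi; exists [:: i], (fun=> 1); split=> [j|].
  by rewrite inE => /eqP ->.
by rewrite big_seq1 scale1r.
Qed.

Lemma lin_combZ a u : lin_comb u -> lin_comb (a *: u).
Proof.
move=> [s [c [Bs ->]]]; exists s, (fun i => a * c i); split=> //.
by rewrite scaler_sumr; apply: eq_bigr => i _; rewrite scalerA.
Qed.

Lemma lin_combD u1 u2 : lin_comb u1 -> lin_comb u2 -> lin_comb (u1 + u2).
Proof.
move=> [s1 [c1 [B1 ->]]] [s2 [c2 [B2 ->]]].
exists (undup (s1 ++ s2)),
  (fun i => c1 i *+ count_mem i s1 + c2 i *+ count_mem i s2).
split=> [i|]; first by rewrite mem_undup mem_cat => /orP[/B1|/B2].
rewrite (@sum_count_mem _ _ s1 (undup (s1 ++ s2))) ?undup_uniq //; last first.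
  by move=> i si; rewrite mem_undup mem_cat si.
rewrite (@sum_count_mem _ _ s2 (undup (s1 ++ s2))) ?undup_uniq //; last first.
  by move=> i si; rewrite mem_undup mem_cat si orbT.
by rewrite -big_split; apply: eq_bigr => i _; rewrite scalerDl !scalerMnl.
Qed.

Lemma lin_comb_sum (J : Type) (s : seq J) (Q : pred J) (F : J -> V) :
  (forall j, Q j -> lin_comb (F j)) -> lin_comb (\sum_(j <- s | Q j) F j).
Proof.
by move=> hF; apply: (big_ind lin_comb lin_comb0 lin_combD).
Qed.

End FiniteCombinations.

(** * Linear independence of monomials *)

(** Uniqueness of digits in base [q]: the remainder modulo [q] gives the lowest digit, the quotient
    gives the others by induction. *)
Lemma base_expansion_inj n q (a b : 'I_n -> nat) :
  (forall i, (a i < q)%N) -> (forall i, (b i < q)%N) ->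
  (\sum_i a i * q ^ i = \sum_i b i * q ^ i)%N -> a =1 b.
Proof.
elim: n a b => [|n IHn] a b lta ltb; first by move=> _ [].
have q_gt0 : (0 < q)%N by apply: leq_ltn_trans (lta ord0).
have split_low (c : 'I_n.+1 -> nat) : (\sum_i c i * q ^ i
    = (\sum_(i < n) c (lift ord0 i) * q ^ i) * q + c ord0)%N.
  rewrite big_ord_recl expn0 muln1 addnC big_distrl; congr (_ + _)%N.
  by apply: eq_bigr => i _; rewrite /= /bump add1n expnSr mulnA.
rewrite !split_low => eq_ab.
have eq0 : a ord0 = b ord0.
  by have := congr1 (modn^~ q) eq_ab; rewrite /= !modnMDl !modn_small.
have /IHn eqS : (\sum_(i < n) a (lift ord0 i) * q ^ i
    = \sum_(i < n) b (lift ord0 i) * q ^ i)%N.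
  have := congr1 (divn^~ q) eq_ab.
  by rewrite /= !divnMDl // !divn_small // !addn0.
by move=> i; case: (unliftP ord0 i) => [j|] ->; [apply: eqS|].
Qed.

(* Kronecker's substitution y i = t ^+ (r.+1 ^ i), normalized to unit sum by
   homogeneity, maps distinct multi-indices to distinct powers of t. *)
Lemma monomials_free (K : realFieldType) n r (s : seq {ffun 'I_n.+1 -> nat})
    (c : {ffun 'I_n.+1 -> nat} -> K) :
  uniq s -> (forall a, a \in s -> (\sum_i a i)%N = r) ->
  (forall y : 'I_n.+1 -> K, (forall i, 0 <= y i) -> \sum_i y i = 1 ->
     \sum_(a <- s) c a * \prod_i y i ^+ a i = 0) ->
  forall a, a \in s -> c a = 0.
Proof.
move=> uniq_s wt_s vanish a sa.
pose N (b : {ffun 'I_n.+1 -> nat}) := (\sum_i b i * r.+1 ^ i)%N.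
pose p : {poly K} := \sum_(b <- s) c b *: 'X^(N b).
have N_inj b : b \in s -> N b = N a -> b = a.
  (* Weight [r] bounds each entry by [r], so the entries are digits in base [r.+1]. *)
  have entry_le d : d \in s -> forall i, (d i < r.+1)%N.
    by move=> sd i; rewrite ltnS -(wt_s d sd) (bigD1 i) //= leq_addr.
  by move=> sb /base_expansion_inj E; apply/ffunP/E; apply: entry_le.
have p_root t : 0 < t -> root p t.
  move=> t_gt0; apply/eqP; pose z (i : 'I_n.+1) := t ^+ (r.+1 ^ i).
  have z_gt0 i : 0 < z i by rewrite exprn_gt0.
  pose Z := \sum_i z i.
  have Z_gt0 : 0 < Z.
    by rewrite /Z big_ord_recl ltr_pwDl // sumr_ge0 // => i _; rewrite ltW.
  have /vanish : forall i, 0 <= z i / Z by move=> i; rewrite divr_ge0 // ltW.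
  rewrite -mulr_suml divff ?gt_eqF // => /(_ erefl) sum0.
  (* All the monomials have degree [r], so the factor [Z ^+ r] clears every denominator at once. *)
  have := congr1 ( *%R^~ (Z ^+ r)) sum0; rewrite /= mul0r => <-.
  rewrite horner_sum mulr_suml !big_seq; apply: eq_bigr => b sb.
  rewrite hornerZ hornerXn -mulrA; congr (_ * _).
  under [in RHS]eq_bigr do rewrite expr_div_n.
  rewrite prodf_div prodrXr (wt_s b sb) divfK ?expf_neq0 ?gt_eqF // /N.
  by rewrite expr_sum; apply: eq_bigr => i _; rewrite -exprM mulnC.
have p0 : p = 0.
  (* The integers from 1 to [size p] are distinct positive roots, one more than the degree of a
     nonzero [p] allows. *)
  apply: (@roots_geq_poly_eq0 _ _ [seq k.+1%:R | k <- iota 0 (size p)]).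
  - by apply/allP => _ /mapP[k _ ->]; apply: p_root; rewrite ltr0n.
  - rewrite map_inj_uniq ?iota_uniq // => i j /eqP.
    by rewrite eqr_nat => /eqP[].
  - by rewrite size_map size_iota.
have := congr1 (fun q : {poly K} => q`_(N a)) p0.
rewrite /p coef_sum coef0 (bigD1_seq a) //= coefZ coefXn eqxx mulr1.
rewrite big_seq_cond big1 ?addr0 // => b /andP[sb neq_ba].
rewrite coefZ coefXn; case: eqP => [Nab|]; last by rewrite mulr0.
by rewrite (N_inj b sb) ?eqxx in neq_ba.
Qed.
(** * The forms attached to one multi-index *)

Section LocalFamily.
Variables (K : numFieldType) (n : nat) (V : lmodType K).
Variables (S : {set 'I_n}) (m : 'I_n) (d : 'I_n -> V).
Hypothesis Sm : m \in S.

(** The sum runs over [S] instead of the face [S :|: [set k]]: they differ only for [k] outside [S],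
    where the coefficient is 0. *)
Definition local_psi k : V :=
  d k - ((k \in S)%:R / #|S|%:R) *: \sum_(j in S) d j.

(** [P] stands for a linear subspace. One gets [d k] first off [S], then the sum over [S] as minus
    the sum off [S], then [d k] for all [k != m], and [d m] from the relation. *)
Lemma local_psi_span (P : V -> Prop) :
  P 0 -> (forall x y, P x -> P y -> P (x + y)) ->
  (forall a x, P x -> P (a *: x)) ->
  \sum_i d i = 0 -> (forall k, k != m -> P (local_psi k)) ->
  forall i, P (d i).
Proof.
move=> P0 PD PZ sum_d Ppsi.
have Psum (Q : pred 'I_n) (F : 'I_n -> V) :
  (forall i, Q i -> P (F i)) -> P (\sum_(i | Q i) F i).
  by move=> PF; apply: big_ind.
have Pout k : k \notin S -> P (d k).
  move=> Sk; have /Ppsi : k != m by apply: contraNneq Sk => ->.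
  by rewrite /local_psi (negPf Sk) mul0r scale0r subr0.
have Psigma : P (\sum_(j in S) d j).
  move: sum_d; rewrite (bigID (mem S)) /= => /(canRL (addrK _)) ->.
  by rewrite sub0r -scaleN1r; apply/PZ/Psum.
have Pneq k : k != m -> P (d k).
  move=> /Ppsi Pk; pose t : K := (k \in S)%:R / #|S|%:R.
  by rewrite -(subrK (t *: \sum_(j in S) d j) (d k)); apply/PD/PZ.
move=> i; have [->|/Pneq //] := eqVneq i m.
move: sum_d; rewrite (bigD1 m) //= => /(canRL (addrK _)) ->.
by rewrite sub0r -scaleN1r; apply/PZ/Psum.
Qed.

Lemma local_psi_free (c : 'I_n -> K) :
  (forall b : 'I_n -> K, \sum_i b i *: d i = 0 -> forall i j, b i = b j) ->
  \sum_(k | k != m) c k *: local_psi k = 0 -> forall k, k != m -> c k = 0.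
Proof.
move=> d_rel sum0.
(* [C] is the total factor of the subtracted sum over [S]; [b k] is the coefficient of [d k] after
   regrouping. *)
pose C := \sum_(k | k != m) c k * ((k \in S)%:R / #|S|%:R).
pose b k := (if k != m then c k else 0) - C * (k \in S)%:R.
have /d_rel b_const : \sum_i b i *: d i = 0.
  rewrite -[RHS]sum0; under eq_bigr do rewrite scalerBl.
  under [RHS]eq_bigr do rewrite scalerBr scalerA.
  rewrite !sumrB -scaler_suml -/C scaler_sumr [in RHS]big_mkcond.
  congr (_ - _); first by apply: eq_bigr => i _; case: ifP; rewrite ?scale0r.
  rewrite [RHS]big_mkcond; apply: eq_bigr => i _.
  by case: (i \in S); rewrite ?mulr1 // mulr0 scale0r.
(* The index [m] has no term of its own, so the common value of [b] is [- C]. Comparison on [S]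
   kills [c] there, hence [C], hence [c] off [S]. *)
have bm : b m = - C by rewrite /b eqxx Sm mulr1 sub0r.
have cS k : k != m -> k \in S -> c k = 0.
  move=> km Sk; have := b_const k m; rewrite bm /b km Sk mulr1.
  by move/(canRL (subrK _)); rewrite addNr.
have C0 : C = 0.
  rewrite /C big1 // => k km; case Sk: (k \in S); last by rewrite mul0r mulr0.
  by rewrite cS ?mul0r.
by move=> k km; have := b_const k m; rewrite bm /b km C0 mul0r subr0 oppr0.
Qed.

End LocalFamily.

(** * Anchored triplets with a given multi-index *)

Section Triplets.
Variable D : nat.
Implicit Types (f : {set 'I_D.+1}) (k : 'I_D.+1) (a : {ffun 'I_D.+1 -> nat}).

(** The premise [j < D] accounts for the default value [D] of the minimum. *)
Lemma ltn_min_label f (j : nat) : (j < D)%N ->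
  (forall i : 'I_D.+1, i \in f -> j < i)%N -> (j < min_label f)%N.
Proof.
move=> ltjD ltjf; apply: (big_ind (fun p => j < p)%N) => // x y ltx lty.
by rewrite leq_min ltx.
Qed.

Lemma min_label_leq f k : k \in f -> (min_label f <= k)%N.
Proof.
rewrite /min_label => fk.
have : k \in index_enum 'I_D.+1 by apply: mem_index_enum.
elim: (index_enum _) => //= i s IHs; rewrite inE big_cons.
case/orP=> [/eqP <-|/IHs le_s]; first by rewrite fk geq_minl.
by case: ifP => // _; apply: leq_trans (geq_minr _ _) le_s.
Qed.

Lemma supp_min a : (0 < weight a)%N ->
  exists2 m, m \in supp a & forall i : 'I_D.+1, i \in supp a -> (m <= i)%N.
Proof.
move=> wt_a; have [i0 Si0] : exists i, i \in supp a.
  apply/existsP; apply: contraTT wt_a => /existsPn S0.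
  rewrite -leqNgt leqn0 /weight sum_nat_eq0; apply/forallP => i /=.
  by have := S0 i; rewrite inE lt0n negbK.
by case: (arg_minnP (fun i : 'I_D.+1 => i : nat) Si0) => m Sm le_m; exists m.
Qed.

(* For k outside the support the anchoring condition is void; for k in the
   support it only excludes the smallest element of the support. *)
Lemma basis_tripletsP r a m f k : (0 < r)%N -> weight a = r ->
  m \in supp a -> (forall i : 'I_D.+1, i \in supp a -> (m <= i)%N) ->
  basis_triplets D r (f, k, a) <-> k != m /\ f = supp a :|: [set k].
Proof.
move=> r_gt0 wt_a Sm le_m; split.
  case=> dim_f fk _ def_f anch; split=> //; apply/eqP => km.
  have def_f' : f = supp a.
    by rewrite -def_f; apply/finset.setUidPl; rewrite finset.sub1set km.
  (* As [f] has positive dimension, it has a label other than its minimum [k]; hence [k < D], and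
     anchoring applies at [k] itself. *)
  have [j fj jk] : exists2 j, j \in f & j != k.
    apply/exists_inP; apply: contraTT dim_f => /exists_inPn fk1.
    rewrite -leqNgt /dim_face -subn1 leq_subLR addn0.
    rewrite -(finset.cards1 k) subset_leq_card //.
    apply/fintype.subsetP => j /fk1.
    by rewrite inE negbK.
  have ltkS i : i \in f -> i != k -> (k < i)%N.
    rewrite def_f' ltn_neqAle => /le_m; rewrite -km => -> ik.
    by rewrite andbT eq_sym.
  have /anch : (k < min_label (f :\ k))%N.
    apply: ltn_min_label => [|i]; last first.
      by rewrite finset.in_setD1 => /andP[? ?]; apply: ltkS.
    by rewrite (leq_trans (ltkS j fj jk)) // -ltnS.
  by rewrite ffunE; move: Sm; rewrite inE -km => ->.
move=> [km ->].
have fm : m \in supp a :|: [set k] by rewrite finset.in_setU Sm.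
have fk : k \in supp a :|: [set k] by rewrite finset.in_setU set11 orbT.
split=> //.
  rewrite /dim_face -subn1 ltn_subRL addn0 (finset.cardsD1 k) fk.
  by rewrite (finset.cardsD1 m) finset.in_setD1 eq_sym km fm.
(* Since [m] lies in [f :\ k], a label below the minimum of that set is below [m], hence outside the
   support. *)
move=> i lti; rewrite ffunE; apply/eqP; rewrite eqb0; apply/negP => ai.
have Si : i \in supp a by rewrite inE.
have := leq_trans lti (min_label_leq (_ : m \in _ :\ k)).
by rewrite finset.in_setD1 eq_sym km fm ltnNge le_m // => /(_ isT).
Qed.

End Triplets.
(** * Barycentric coordinates *)

Section Barycentric.
Variables (R : realType) (D : nat).
Implicit Types (g : 'rV[R]_D -> R) (x h : 'rV[R]_D).

(** Continuity makes a linear form differentiable and equal to its own differential. *)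
Lemma linear_row_continuous (l : {linear 'rV[R]_D -> R^o}) : continuous l.
Proof.
have -> : (l : _ -> _) = (fun y => \sum_j y ord0 j *: l (delta_mx 0 j)).
  apply/funext => y; rewrite {1}[y]row_sum_delta linear_sum.
  by apply: eq_bigr => j _; rewrite linearZ.
apply: continuous_big => [|j _]; first exact: add_continuous.
by move=> y; apply: (cvgZr_tmp (FF := nbhs_filter y)); exact: coord_continuous.
Qed.

(** The right-hand side is the linear part of [g]; later computations with [ext_d] rest on this
    formula. *)
Lemma ext_d_affine g x h : affine g -> ext_d g x h = g h - g 0.
Proof.
move=> [l [b gE]].
have cont_l := @linear_row_continuous l.
have -> : ext_d g x = linfun l.
  rewrite /ext_d; congr linfun.
  have -> : (g : 'rV[R]_D -> R^o) =
      (l : 'rV[R]_D -> R^o) + cst (b : R^o).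
    by apply/funext => y; rewrite gE.
  rewrite diffD //; last exact: linear_differentiable.
  rewrite diff_cst diff_lin //; apply/funext => y.
  exact: (addr0 (l y)).
by rewrite lfunE /= !gE linear0 add0r addrK.
Qed.

Lemma ext_d_affine_cst g x y : affine g -> ext_d g x = ext_d g y.
Proof.
move=> g_aff; apply/lfunP => h.
exact: etrans (ext_d_affine x h g_aff) (esym (ext_d_affine y h g_aff)).
Qed.

Lemma affineB g x y : affine g -> g (x - y) - g 0 = g x - g y.
Proof.
move=> [l [b gE]]; rewrite !gE linearB linear0 add0r addrK.
by rewrite opprD addrACA subrr addr0.
Qed.

Variables (v : 'I_D.+1 -> 'rV[R]_D) (xi : 'I_D.+1 -> 'rV[R]_D -> R).
Hypotheses (hv : nondegenerate_simplex v) (hxi : barycentric v xi).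

Lemma affine_sum g (c : 'I_D.+1 -> R) : affine g -> \sum_i c i = 1 ->
  g (\sum_i c i *: v i) = \sum_i c i * g (v i).
Proof.
move=> [l [b gE]] sum_c; rewrite gE linear_sum.
under [RHS]eq_bigr do rewrite gE mulrDr.
rewrite big_split /= -mulr_suml sum_c mul1r; congr (_ + _).
by apply: eq_bigr => i _; rewrite linearZ.
Qed.

Lemma bary_eval (c : 'I_D.+1 -> R) k : \sum_i c i = 1 ->
  xi k (\sum_i c i *: v i) = c k.
Proof.
move=> sum_c; rewrite affine_sum //; last exact: hxi.1.
rewrite (bigD1 k) //= hxi.2 eqxx mulr1 big1 ?addr0 // => i ik.
by rewrite hxi.2 eq_sym (negPf ik) mulr0.
Qed.

(** By nondegeneracy the [D] edge vectors issuing from [v ord0] are independent, hence a basis of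
    the ambient space; [x - v ord0] is expanded in it. *)
Lemma affine_hull x :
  exists2 c : 'I_D.+1 -> R, \sum_i c i = 1 & x = \sum_i c i *: v i.
Proof.
pose M : 'M[R]_D := \matrix_(i, j) (v (lift ord0 i) - v ord0) ord0 j.
have mulM (u : 'rV_D) :
    u *m M = \sum_i u ord0 i *: v (lift ord0 i) - (\sum_i u ord0 i) *: v ord0.
  rewrite scaler_suml -sumrB; apply/rowP => j; rewrite mxE summxE.
  by apply: eq_bigr => i _; rewrite !mxE mulrBr.
have unitM : M \in unitmx.
  rewrite -row_free_unit -kermx_eq0; apply/rowV0P => u /sub_kermxP.
  rewrite mulM => u0; apply/rowP => i; rewrite mxE.
  (* A relation between edge vectors becomes one between vertices, with the coefficient at vertex 0
     chosen to make the sum zero. *)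
  pose c (k : 'I_D.+1) :=
    if unlift ord0 k is Some i' then u ord0 i' else - \sum_i u ord0 i.
  have c0 : c ord0 = - \sum_i u ord0 i by rewrite /c unlift_none.
  have cS i' : c (lift ord0 i') = u ord0 i' by rewrite /c liftK.
  rewrite -cS; apply: (hv (c := c)); rewrite big_ord_recl c0.
    by under [X in _ + X]eq_bigr do rewrite cS; rewrite addNr.
  by under [X in _ + X]eq_bigr do rewrite cS; rewrite addrC scaleNr.
pose u := (x - v ord0) *m invmx M.
exists (fun k => if unlift ord0 k is Some i then u ord0 i
                 else 1 - \sum_i u ord0 i).
  rewrite big_ord_recl unlift_none; under [X in _ + X]eq_bigr do rewrite liftK.
  by rewrite subrK.
rewrite big_ord_recl unlift_none; under [X in _ + X]eq_bigr do rewrite liftK.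
have := mulmxKV unitM (x - v ord0); rewrite -/u mulM => /(canRL (subrK _)) xE.
by rewrite xE scalerBl scale1r [X in _ + X]addrC addrA subrK addrC subrK.
Qed.

Lemma sum_bary x : \sum_i xi i x = 1.
Proof.
have [c sum_c ->] := affine_hull x; rewrite -[RHS]sum_c.
by apply: eq_bigr => i _; rewrite bary_eval.
Qed.

Lemma bary_sum x : x = \sum_i xi i x *: v i.
Proof.
have [c sum_c ->] := affine_hull x; apply: eq_bigr => i _.
by rewrite bary_eval.
Qed.

Lemma sum_ext_d x : \sum_i ext_d (xi i) x = 0.
Proof.
apply/lfunP => h; rewrite sum_lfunE zero_lfunE.
transitivity (\sum_i (xi i h - xi i 0)).
  by apply: eq_bigr => i _; apply: ext_d_affine; exact: hxi.1.
by rewrite sumrB !sum_bary subrr.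
Qed.

(** Evaluation on the edge vector [v i - v j] leaves exactly [b i - b j]. *)
Lemma ext_d_rel (b : 'I_D.+1 -> R) x :
  \sum_i b i *: ext_d (xi i) x = 0 -> forall i j, b i = b j.
Proof.
move=> /lfunP rel i j; have := rel (v i - v j).
rewrite sum_lfunE zero_lfunE.
have dE k : ext_d (xi k) x (v i - v j) = (k == i)%:R - (k == j)%:R.
  by rewrite ext_d_affine ?affineB ?hxi.2 //; exact: hxi.1.
have -> : \sum_k (b k *: ext_d (xi k) x) (v i - v j) = b i - b j.
  transitivity (\sum_k (b k * (k == i)%:R - b k * (k == j)%:R)).
    by apply: eq_bigr => k _; rewrite scale_lfunE dE -mulrBr.
  rewrite sumrB (bigD1 i) //= eqxx mulr1.
  rewrite [in X in _ - X](bigD1 j) //= eqxx mulr1.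
  by rewrite !big1 ?addr0 // => k /negPf ->; rewrite mulr0.
by move/eqP; rewrite subr_eq0 => /eqP.
Qed.

End Barycentric.
(** * Spaces of 1-forms *)

Section Forms.
Variables (R : realType) (D r : nat).
Variables (v : 'I_D.+1 -> 'rV[R]_D) (xi : 'I_D.+1 -> 'rV[R]_D -> R).
Hypotheses (hv : nondegenerate_simplex v) (hxi : barycentric v xi).
Local Notation form1 := (simplex v -> 'Hom('rV[R]_D, R^o)).
Local Notation multi_index := {ffun 'I_D.+1 -> nat}.
Implicit Types (a : multi_index) (k : 'I_D.+1).

Lemma weight_indic a : weight (indic a) = #|supp a|.
Proof.
rewrite /weight -sum1_card [RHS]big_mkcond; apply: eq_bigr => i _.
by rewrite ffunE inE; case: (0 < a i)%N.
Qed.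

Lemma psi_localE a k x : psi xi (supp a :|: [set k]) k (indic a) x =
  local_psi (supp a) (fun i => ext_d (xi i) x) k.
Proof.
rewrite /psi /local_psi weight_indic ffunE.
have -> : (0 < a k)%N = (k \in supp a) by rewrite inE.
case: (boolP (k \in supp a)) => Sk; last by rewrite !mul0r !scale0r.
suff -> : supp a :|: [set k] = supp a by [].
by apply/finset.setUidPl; rewrite finset.sub1set.
Qed.

(** For [a] of weight [r], these elementary forms generate the whole space and mediate between it
    and the forms [w_form]. *)
Definition dform a i : form1 :=
  fun x => bern xi a (val x) *: ext_d (xi i) (val x).

Lemma w_form_localE a k :
  w_form v xi (supp a :|: [set k], k, a) = local_psi (supp a) (dform a) k.
Proof.
apply/funext => x; rewrite /w_form psi_localE /local_psi.
rewrite -[RHS]/(dform a k x - _ *: (\sum_(j in supp a) dform a j) x).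
by rewrite fct_sumE scalerBr scalerA mulrC -scalerA scaler_sumr.
Qed.

Lemma poly_fun_on_affine g : affine g ->
  Defs.PolyFun.poly_fun_on 1 (fun x : simplex v => val x ord0)
    (fun x => g (val x)).
Proof.
move=> [l [b gE]].
have -> : (fun x : simplex v => g (val x)) =
    (fun x => \sum_j val x ord0 j * l (delta_mx 0 j) + b).
  apply/funext => x; rewrite gE {1}[val x]row_sum_delta linear_sum.
  by congr (_ + _); apply: eq_bigr => j _; rewrite linearZ.
apply: PolyFunTheory.poly_fun_onD; last exact: PolyFunTheory.poly_fun_on_cst.
apply: PolyFunTheory.poly_fun_on_sum => j.
apply: (PolyFunTheory.poly_fun_onM (r := 1) (s := 0)).
  exact: PolyFunTheory.poly_fun_on_coor.
exact: PolyFunTheory.poly_fun_on_cst.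
Qed.

Lemma poly_space_bern a : weight a = r ->
  poly_space v r (fun x => bern xi a (val x)).
Proof.
move=> <-; apply: PolyFunTheory.poly_fun_on_prod => i.
have := PolyFunTheory.poly_fun_onX (a i) (poly_fun_on_affine (hxi.1 i)).
by rewrite muln1.
Qed.

Lemma form_spaceD (u1 u2 : form1) : form_space v xi r u1 ->
  form_space v xi r u2 -> form_space v xi r (u1 + u2).
Proof.
move=> [p [hp ->]] [q [hq ->]]; exists (fun i x => p i x + q i x); split.
  by move=> i; exact: PolyFunTheory.poly_fun_onD (hp i) (hq i).
apply/funext => x; rewrite -[LHS]/(_ + _) -big_split.
by apply: eq_bigr => i _; rewrite scalerDl.
Qed.

Lemma form_spaceZ c (u : form1) :
  form_space v xi r u -> form_space v xi r (c *: u).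
Proof.
move=> [p [hp ->]]; exists (fun i x => c * p i x); split=> [i|].
  apply: (PolyFunTheory.poly_fun_onM (r := 0) (s := r)) (hp i).
  exact: PolyFunTheory.poly_fun_on_cst.
apply/funext => x; rewrite -[LHS]/(_ *: _) scaler_sumr.
by apply: eq_bigr => i _; rewrite scalerA.
Qed.

Lemma form_space_dform a i : weight a = r -> form_space v xi r (dform a i).
Proof.
move=> wt_a; exists (fun j x => if j == i then bern xi a (val x) else 0); split.
  move=> j; case: (j == i); first exact: poly_space_bern.
  exact: PolyFunTheory.poly_fun_on_cst.
apply/funext => x; rewrite (bigD1 i) //= eqxx big1 ?addr0 // => j /negPf ->.
by rewrite scale0r.
Qed.

Lemma form_space0 : form_space v xi r 0.
Proof.
exists (fun _ _ => 0); split=> [i|]; first exact: PolyFunTheory.poly_fun_on_cst.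
by apply/funext => x; rewrite big1 // => i _; rewrite scale0r.
Qed.

Lemma form_space_sum (I : Type) (s : seq I) (Q : pred I) (F : I -> form1) :
  (forall i, Q i -> form_space v xi r (F i)) ->
  form_space v xi r (\sum_(i <- s | Q i) F i).
Proof.
by move=> hF; apply: big_ind => //; [apply: form_space0|apply: form_spaceD].
Qed.

Lemma form_space_w t : basis_triplets D r t ->
  form_space v xi r (w_form v xi t).
Proof.
case: t => [[f k] a] [_ _ wt_a <- _]; rewrite w_form_localE.
apply: form_spaceD; first exact: form_space_dform.
rewrite -scaleN1r; do 2!apply: form_spaceZ.
by apply: form_space_sum => j _; apply: form_space_dform.
Qed.

(** * Generation *)

Lemma form_space_dform_comb u : form_space v xi r u ->
  exists (s : 'I_D.+1 -> seq multi_index) (c : 'I_D.+1 -> multi_index -> R),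
    (forall i a, a \in s i -> weight a = r) /\
    u = \sum_i \sum_(a <- s i) c i a *: dform a i.
Proof.
move=> [p [hp ->]].
have homog i : exists sc : seq multi_index * (multi_index -> R),
    (forall a, a \in sc.1 -> weight a = r) /\
    forall x, p i x = \sum_(a <- sc.1) sc.2 a * bern xi a (val x).
  (* The Cartesian coordinates of a point are combinations of its barycentric ones, with those of
     the vertices as coefficients. *)
  have [||s [c [wt_s pE]]] := PolyFunTheory.poly_fun_on_homogenize
    (y := fun x : simplex v => xi ^~ (val x))
    (A := fun j i => v i ord0 j) _ _ (hp i).
  - by move=> x; apply: sum_bary hv hxi _.
  - move=> x j; rewrite {1}[val x](bary_sum hv hxi) summxE.
    by apply: eq_bigr => k _; rewrite mxE mulrC.
  - by exists (s, c).
have [sc sc_p] := choice homog.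
exists (fun i => (sc i).1), (fun i => (sc i).2); split=> [i|].
  exact: (sc_p i).1.
apply/funext => x; rewrite fct_sumE; apply: eq_bigr => i _.
rewrite fct_sumE (sc_p i).2 scaler_suml; apply: eq_bigr => a _.
by rewrite -scalerA.
Qed.

(** For fixed [a] the common factor [bern xi a] preserves the relation among the differentials, so
    [local_psi_span] applies to the forms [dform a] themselves. *)
Lemma dform_lin_comb a i : (0 < r)%N -> weight a = r ->
  lin_comb (basis_triplets D r) (w_form v xi) (dform a i).
Proof.
move=> r_gt0 wt_a.
have [|m Sm le_m] := @supp_min D a; first by rewrite wt_a.
apply: (local_psi_span Sm (P := lin_comb (basis_triplets D r) (w_form v xi))).
- exact: lin_comb0.
- exact: lin_combD.
- exact: lin_combZ.
- apply/funext => x; rewrite fct_sumE -scaler_sumr (sum_ext_d hv hxi).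
  by rewrite scaler0.
- move=> k km; rewrite -w_form_localE; apply: lin_comb_gen.
  exact/(basis_tripletsP _ _ r_gt0 wt_a Sm le_m).
Qed.

Lemma form_spaceP u : (0 < r)%N ->
  form_space v xi r u <-> lin_comb (basis_triplets D r) (w_form v xi) u.
Proof.
move=> r_gt0; split=> [/form_space_dform_comb[s [c [wt_s ->]]]|[s [c [Bs ->]]]].
  apply: lin_comb_sum => i _; rewrite big_seq; apply: lin_comb_sum => a sa.
  by apply/lin_combZ/dform_lin_comb => //; apply: wt_s sa.
rewrite big_seq; apply: form_space_sum => t st.
exact/form_spaceZ/form_space_w/Bs.
Qed.

(** * Linear independence *)

(** Every nonnegative tuple of sum 1 is the tuple of barycentric coordinates of a point of the
    simplex. *)
Lemma bern_free (s : seq multi_index) (c : multi_index -> R) :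
  uniq s -> (forall a, a \in s -> weight a = r) ->
  (forall x : simplex v, \sum_(a <- s) c a * bern xi a (val x) = 0) ->
  forall a, a \in s -> c a = 0.
Proof.
move=> uniq_s wt_s vanish; apply: (monomials_free uniq_s wt_s) => y y_ge0 sum_y.
have yP : simplex v (\sum_i y i *: v i) by exists y.
rewrite -[RHS](vanish (SigSub (mem_set yP))) /=.
apply: eq_bigr => a _; congr (_ * _); apply: eq_bigr => i _.
by rewrite bary_eval.
Qed.

(** Terms are grouped by multi-index: independence of the monomials isolates each group, and
    [local_psi_free] settles the group. *)
Lemma w_form_free (s : seq ({set 'I_D.+1} * 'I_D.+1 * multi_index))
    (c : _ -> R) :
  (0 < r)%N -> uniq s -> (forall t, t \in s -> basis_triplets D r t) ->
  \sum_(t <- s) c t *: w_form v xi t = 0 -> forall t, t \in s -> c t = 0.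
Proof.
move=> r_gt0 uniq_s Bs sum0.
(* The face of a basis triplet is determined by [a] and [k]. *)
pose T a k := (supp a :|: [set k], k, a).
pose A := undup [seq t.2 | t <- s].
(* This rectangular list may contain triplets outside the basis; they do not occur in [s] and get
   coefficient 0. *)
pose L := [seq T a k | a <- A, k <- index_enum 'I_D.+1].
have wt_A a : a \in A -> weight a = r.
  by rewrite mem_undup => /mapP[[[f k] a'] /Bs[_ _ <- _ _] ->].
have TE t : t \in s -> t = T t.2 t.1.2.
  by case: t => [[f k] a] /Bs[_ _ _ <- _].
have uniqL : uniq L.
  apply: allpairs_uniq; rewrite ?undup_uniq ?index_enum_uniq //.
  by move=> [a k] [a' k'] _ _ [_ -> ->].
have subL : {subset s <= L}.
  move=> t st; rewrite (TE t st); apply: allpairs_f; last exact: mem_index_enum.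
  by rewrite mem_undup; apply: map_f.
pose d a k := c (T a k) *+ count_mem (T a k) s.
(* Differentials of affine functions are constant, so the base point 0 serves for all points. *)
pose dxi i := ext_d (xi i) 0.
pose e a := \sum_k d a k *: local_psi (supp a) dxi k.
have sum_e (x : simplex v) : \sum_(a <- A) bern xi a (val x) *: e a = 0.
  transitivity ((\sum_(t <- s) c t *: w_form v xi t) x); last by rewrite sum0.
  rewrite (sum_count_mem _ uniqL subL) big_allpairs_dep fct_sumE.
  apply: eq_bigr => a _; rewrite fct_sumE scaler_sumr; apply: eq_bigr => k _.
  have dxiE : (fun i => ext_d (xi i) (val x)) = dxi.
    by apply/funext => i; apply/ext_d_affine_cst/hxi.1.
  have psiE := psi_localE a k (val x); rewrite dxiE in psiE.
  rewrite scalerMnl -[RHS]/(d a k *: (bern xi a (val x) *: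
    psi xi (supp a :|: [set k]) k (indic a) (val x))).
  rewrite psiE; move: (local_psi _ _ _) => p.
  by rewrite !scalerA mulrC.
have e0 a : a \in A -> e a = 0.
  (* Evaluating the covectors at a fixed [h] gives a scalar relation between monomials. *)
  move=> Aa; apply/lfunP => h; rewrite zero_lfunE.
  apply: (bern_free (c := fun a => e a h) (undup_uniq _) wt_A _ Aa) => x.
  rewrite -[RHS](zero_lfunE _ h) -(sum_e x) sum_lfunE.
  by apply: eq_bigr => b _; rewrite scale_lfunE mulrC.
move=> t st; rewrite (TE t st); have := Bs t st; rewrite (TE t st).
move: (t.2) (t.1.2) (TE t st) => a k tE Bt.
have wt_a : weight a = r by case: Bt.
have [|m Sm le_m] := @supp_min D a; first by rewrite wt_a.
have B_neq f k' := basis_tripletsP f k' r_gt0 wt_a Sm le_m.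
have dm : d a m = 0.
  rewrite /d (count_memPn _) ?mulr0n //; apply/negP => /Bs /B_neq[].
  by rewrite eqxx.
have Aa : a \in A by rewrite mem_undup; apply/mapP; exists t => //; rewrite tE.
have km : k != m by case/B_neq: Bt.
have := e0 a Aa; rewrite /e (bigD1 m) //= dm scale0r add0r.
move/(local_psi_free Sm (fun b => ext_d_rel hxi (b := b) (x := 0)))/(_ k km).
by rewrite /d count_uniq_mem // -tE st mulr1n.
Qed.

End Forms.

Theorem corollary1 (R : realType) (D r : nat) (hD : (1 <= D)%N) (hr : (1 <= r)%N)
    (v : 'I_D.+1 -> 'rV[R]_D) (hv : nondegenerate_simplex v)
    (xi : 'I_D.+1 -> 'rV[R]_D -> R) (hxi : barycentric v xi) :
  is_basis (basis_triplets D r) (w_form v xi) (form_space v xi r).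
Proof.
split=> [s c uniq_s Bs sum0 t st|u]; last exact: form_spaceP.
exact: (w_form_free hxi hr uniq_s Bs sum0 st).
Qed.
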